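(* For any (Hausdorff) right topological group $G$, the pair $(\beta G_d/\Phi,\mathfrak h_\Phi)$ is the universal chartification of $G$, where $\Phi$ is the least closed congruence on $\beta G_d$ such that $$\{(u,1_G):u\in\beta G_d\text{ is idempotent}\}\cup\{(u,1_G):u\in\mathrm{Ult}(G)\}\subset\Phi,$$ and $\mathfrak h_\Phi:G\to\beta G_d/\Phi$ is given by $\mathfrak h_\Phi(x)=[x]_\Phi$.
   Context: All topological spaces are assumed Hausdorff. A right topological semigroup (group) is a semigroup (group) $S$ with a topology such that for each $s\in S$ the right shift $x\mapsto xs$ is continuous. For such $S$, its topological center is $\Lambda(S)=\{s\in S:\text{the left shift } x\mapsto sx\text{ is continuous}\}$. A right topological group $G$ is admissible if $\Lambda(G)$ is dense in $G$. A chart group is a compact Hausdorff admissible right topological group. $G_d$ denotes the group $G$ endowed with the discrete topology. For a discrete semigroup $S$, $\beta S$ is the Stone-Čech compactification of $S$: the set of all ultrafilters on $S$ with the topology given by the base of sets $\{u\in\beta S:A\in u\}$, $A\subseteq S$; each $x\in S$ is identified with the principal ultrafilter $\{A\subseteq S:x\in A\}$. The operation of $S$ extends to $\beta S$ by: $A\in uv$ iff $\{s\in S:\{t\in S: st\in A\}\in v\}\in u$; with it $\beta S$ is a compact right topological semigroup. An ultrafilter $u\in\beta S$ is idempotent if $uu=u$. $\mathrm{Ult}(G)$ is the set of all ultrafilters on $G$ convergent to the unit $1_G$ in the topology of $G$. A congruence on a semigroup $S$ is an equivalence relation $\rho$ such that $(a_1,b_1),(a_2,b_2)\in\rho$ imply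 $(a_1a_2,b_1b_2)\in\rho$; $[x]_\rho$ is the $\rho$-class of $x$ and $S/\rho$ is the quotient semigroup, with operation $[x]_\rho[y]_\rho=[xy]_\rho$ and the quotient topology. A congruence on $\beta G_d$ is closed if it is a closed subset of $\beta G_d\times\beta G_d$; intersections of closed congruences are closed congruences, so the least closed congruence containing a given relation exists. A universal chartification of a right topological group $G$ is a pair $(\mathfrak cG,c)$ consisting of a chart group $\mathfrak cG$ and a continuous homomorphism $c:G\to\mathfrak cG$ such that: (i) $c(G)$ is dense in $\mathfrak cG$; (ii) $c(G)\subseteq\Lambda(\mathfrak cG)$; (iii) for each chart group $H$ and continuous homomorphism $f:G\to H$ with $f(G)\subseteq\Lambda(H)$ there exists a continuous homomorphism $g:\mathfrak cG\to H$ such that $f=g\circ c$. *)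

(* Defs.v *)
From HB Require Import structures.
From mathcomp Require Import all_boot all_classical topology.
Set Implicit Arguments.
Unset Strict Implicit.
Unset Printing Implicit Defensive.

Local Open Scope classical_set_scope.
Local Open Scope group_scope.
Local Open Scope quotient_scope.

(* These two structures only put a topology next to the algebraic operations;
   compatibility is expressed by the predicates below. *)
#[short(type="topologizedSemigroupType")]
HB.structure Definition TopologizedSemigroup :=
  {S of Topological S & Semigroup S}.

#[short(type="topologizedGroupType")]
HB.structure Definition TopologizedGroup := {G of Topological G & Group G}.

Definition right_topological (S : topologizedSemigroupType) : Prop :=
  forall s : S, continuous (fun x : S => x * s).

Definition topological_center (S : topologizedSemigroupType) : set S :=
  [set s : S | continuous (fun x : S => s * x)].
Arguments topological_center S : clear implicits.

Definition admissible (S : topologizedSemigroupType) : Prop :=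
  dense (topological_center S).

Definition is_group (S : semigroupType) : Prop :=
  exists e : S, (forall x, e * x = x /\ x * e = x) /\
                (forall x, exists y, y * x = e /\ x * y = e).

(* Being a group is a property of a semigroup here, because the quotient
   semigroup below is not a group by construction. *)
Definition chart_group (S : topologizedSemigroupType) : Prop :=
  [/\ is_group S, right_topological S, admissible S,
      compact [set: S] & hausdorff_space S].

Definition homomorphism (S T : semigroupType) (f : S -> T) : Prop :=
  {morph f : x y / x * y}.

Definition universal_chartification (G C : topologizedSemigroupType)
    (c : G -> C) : Prop :=
  [/\ chart_group C,
      continuous c /\ homomorphism c,
      dense (range c),
      range c `<=` topological_center C
    & forall (H : topologizedSemigroupType) (f : G -> H),
        chart_group H -> continuous f -> homomorphism f ->
        range f `<=` topological_center H ->
        exists g : C -> H, [/\ continuous g, homomorphism g & f = g \o c]].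

Section Congruences.
Variable S : topologizedSemigroupType.

Definition congruence (rho : set (S * S)) : Prop :=
  [/\ forall x, rho (x, x),
      forall x y, rho (x, y) -> rho (y, x),
      forall x y z, rho (x, y) -> rho (y, z) -> rho (x, z)
    & forall a1 b1 a2 b2, rho (a1, b1) -> rho (a2, b2) ->
        rho (a1 * a2, b1 * b2)].

Definition closed_congruence (rho : set (S * S)) : Prop :=
  congruence rho /\ closed rho.

Record congr := Congr {
  congr_set : set (S * S);
  congrP : congruence congr_set }.

Lemma smallest_closed_congruence (R : set (S * S)) :
  closed_congruence (smallest closed_congruence R).
Proof.
split; last by apply: closed_bigI => rho [[]].
split.
- by move=> x rho [[[r _ _ _] _] _]; exact: r.
- move=> x y xy rho [cr Rr]; case: (cr) => -[_ s _ _] _; apply: s.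
  exact: xy.
- move=> x y z xy yz rho [cr Rr]; case: (cr) => -[_ _ t _] _.
  by apply: (t _ y); [exact: xy|exact: yz].
- move=> a1 b1 a2 b2 ab1 ab2 rho [cr Rr]; case: (cr) => -[_ _ _ m] _.
  by apply: m; [exact: ab1|exact: ab2].
Qed.

Definition least_closed_congruence (R : set (S * S)) : congr :=
  Congr (smallest_closed_congruence R).1.

Variable rho : congr.

Definition congr_rel : rel S := fun x y => `[< congr_set rho (x, y) >].

Lemma congr_rel_equiv : equiv_class_of congr_rel.
Proof.
case: (congrP rho) => r s t _; split.
- by move=> x; apply/asboolP; exact: r.
- by move=> x y; apply/asboolP/asboolP; exact: s.
- by move=> y x z /asboolP xy /asboolP yz; apply/asboolP; exact: t yz.
Qed.

Canonical congr_equiv_rel := EquivRelPack congr_rel_equiv.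

Definition congr_quotient : Type :=
  quotient_topology {eq_quot congr_equiv_rel}.

HB.instance Definition _ := Topological.on congr_quotient.
HB.instance Definition _ := Quotient.on congr_quotient.

Definition congr_class (x : S) : congr_quotient := \pi_congr_quotient x.

Lemma congr_classP (x y : S) : congr_class x = congr_class y <-> congr_set rho (x, y).
Proof.
rewrite /congr_class; split.
  by move=> /(@eqmodP _ congr_equiv_rel) /asboolP.
by move=> xy; apply/(@eqmodP _ congr_equiv_rel)/asboolP.
Qed.

Definition congr_quotient_mul (a b : congr_quotient) : congr_quotient :=
  congr_class (repr a * repr b).

Lemma congr_quotient_mulE (x y : S) :
  congr_quotient_mul (congr_class x) (congr_class y) = congr_class (x * y).
Proof.
case: (congrP rho) => _ _ _ m; apply/congr_classP.
by apply: m; apply/congr_classP; rewrite /congr_class reprK.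
Qed.

Lemma congr_quotient_mulA : associative congr_quotient_mul.
Proof.
move=> a b c; rewrite -[a]reprK -[b]reprK -[c]reprK -!/(congr_class _).
by rewrite !congr_quotient_mulE mulgA.
Qed.

HB.instance Definition _ :=
  isSemigroup.Build congr_quotient congr_quotient_mulA.

End Congruences.

(* The Stone-Cech compactification of the semigroup S taken with the discrete
   topology: a topology carried by S is not used. *)
Record beta (S : Type) : Type := Beta {
  beta_filter :> set S -> Prop;
  beta_ultra : UltraFilter beta_filter }.

HB.instance Definition _ (S : Type) := gen_eqMixin (beta S).
HB.instance Definition _ (S : Type) := gen_choiceMixin (beta S).

Section Beta.
Variable S : semigroupType.
Implicit Types u v w : beta S.

Lemma beta_eqP u v : (forall A : set S, u A <-> v A) -> u = v.
Proof.
case: u v => [u Uu] [v Uv] /= uv.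
have E : u = v by apply/funext => A; apply/propext; exact: uv.
by case: _ / E Uv {uv} => Uv; rewrite (Prop_irrelevance Uu Uv).
Qed.

Definition beta_basic (A : set S) : set (beta S) := [set u : beta S | u A].

Lemma beta_basic_cover : \bigcup_(A in [set: set S]) beta_basic A = setT.
Proof.
rewrite -subTset => u _; exists setT => //.
by have := beta_ultra u => ?; exact: filterT.
Qed.

Lemma beta_basic_join (A B : set S) u :
  [set: set S] A -> [set: set S] B -> beta_basic A u -> beta_basic B u ->
  exists C, [/\ [set: set S] C, beta_basic C u
              & beta_basic C `<=` beta_basic A `&` beta_basic B].
Proof.
move=> _ _ uA uB; exists (A `&` B); split => //.
  by have := beta_ultra u => ?; exact: filterI.
move=> v vAB; have := beta_ultra v => ?.
by split; apply: filterS vAB => x [].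
Qed.

HB.instance Definition _ :=
  isBaseTopological.Build (beta S) beta_basic_cover beta_basic_join.

Definition beta_mul_sets u v : set_system S :=
  [set A | u [set s | v [set t | A (s * t)]]].

Lemma beta_mul_ultra u v : UltraFilter (beta_mul_sets u v).
Proof.
have Uu := beta_ultra u; have Uv := beta_ultra v.
have FF : ProperFilter (beta_mul_sets u v).
  apply: Build_ProperFilter_ex.
    move=> A uvA; have [s vs] := @filter_ex _ (beta_filter u) _ _ uvA.
    by have [t At] := @filter_ex _ (beta_filter v) _ _ vs; exists (s * t).
  split.
  - by apply: (@filterE _ (beta_filter u)) => s; exact: filterT.
  - move=> A B uA uB; apply: (@filterS2 _ (beta_filter u) _ _ _ _ _ uA uB).
    by move=> s; exact: filterI.
  - move=> A B AB; apply: (@filterS _ (beta_filter u)) => s.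
    by apply: (@filterS _ (beta_filter v)) => t; exact: AB.
split=> // F PF uvF; apply/seteqP; split => // A FA.
have [uA|uA] := in_ultra_setVsetC [set s | v [set t | A (s * t)]] Uu.
  by [].
suff /uvF FnA : beta_mul_sets u v (~` A).
  by have [x []] := filter_ex (@filterI _ F _ _ _ FA FnA).
apply: (@filterS _ (beta_filter u) _ _ _ _ uA) => s /= nA.
by have [//|] := in_ultra_setVsetC [set t | A (s * t)] Uv.
Qed.

Definition beta_mul u v : beta S := Beta (beta_mul_ultra u v).

Lemma beta_mulA : associative beta_mul.
Proof.
move=> u v w; apply: beta_eqP => A; rewrite /= /beta_mul_sets /=.
have E s r : [set t | A (s * (r * t))] = [set t | A (s * r * t)].
  by apply/funext => t /=; rewrite mulgA.
have E' s : [set r | w [set t | A (s * (r * t))]] =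
            [set r | w [set t | A (s * r * t)]].
  by apply/funext => r /=; rewrite E.
suff -> : [set s | v [set r | w [set t | A (s * (r * t))]]] =
          [set s | v [set r | w [set t | A (s * r * t)]]] by [].
by apply/funext => s /=; rewrite E'.
Qed.

HB.instance Definition _ := isSemigroup.Build (beta S) beta_mulA.

Definition beta_principal (x : S) : beta S := Beta (principal_filter_ultra x).

End Beta.

Definition idempotents (S : semigroupType) : set (beta S) :=
  [set u : beta S | u * u = u].
Arguments idempotents S : clear implicits.

Definition Ult (G : topologizedGroupType) : set (beta G) :=
  [set u : beta G | (u : set_system G) --> (1 : G)].
Arguments Ult G : clear implicits.

Definition Phi_generators (G : topologizedGroupType) : set (beta G * beta G) :=
  [set (u, beta_principal (1 : G)) | u in idempotents G] `|`
  [set (u, beta_principal (1 : G)) | u in Ult G].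
Arguments Phi_generators G : clear implicits.

Definition Phi (G : topologizedGroupType) : congr (beta G) :=
  least_closed_congruence (Phi_generators G).

Definition h_Phi (G : topologizedGroupType) (x : G) : congr_quotient (Phi G) :=
  congr_class (Phi G) (beta_principal x).

(* Main.v *)
Require Import Defs.
From mathcomp Require Import all_boot all_classical topology.
(** Write q for the quotient map from beta G onto beta G / Phi.

    The quotient is a chart group.  It is compact as an image of beta G, and
    Hausdorff because Phi is closed and beta G is compact Hausdorff.  Right
    shifts are continuous on beta G, and so are the left shifts by principal
    ultrafilters; both facts descend to the quotient, so that h_Phi lands in
    the topological center, and its range is dense because the principal
    ultrafilters are dense in beta G.  Inverses come from the Ellis-Numakura
    theorem ([ellis_numakura]): the closed left ideal (beta G) u contains an
    idempotent v u, which Phi identifies with 1, so q(v) is a left inverse of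
    q(u).  A monoid in which every element has a left inverse is a group.

    Continuity of h_Phi is what the second family of generators buys: if an
    ultrafilter u converges to x in G, then u x^-1 converges to 1, hence
    q(u x^-1) = 1 and q(u) = h_Phi(x) ([Phi_cvg]).  The images of the points of
    G along u converge to q(u), so h_Phi preserves limits of ultrafilters.

    For the universal property, a map f from G to a chart group H extends to a
    continuous map F on beta G ([beta_extension]).  F is multiplicative since
    the range of f lies in the center of H: the identity F(uv) = F(u)F(v)
    passes from G to beta G first in v, by continuity of left shifts by
    central elements, then in u, by continuity of right shifts
    ([beta_extension_morph]).  The kernel of F is a closed congruence; it
    contains the generators of Phi because a group has a single idempotent and
    f is continuous at 1 ([Phi_sub_kernel]).  Hence it contains Phi, and F
    factors through the quotient. *)

Set Implicit Arguments.
Unset Strict Implicit.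
Unset Printing Implicit Defensive.

Local Open Scope classical_set_scope.
Local Open Scope group_scope.
Local Open Scope quotient_scope.

(** * Topological preliminaries *)

Lemma compact_hausdorff_separation (T : topologicalType) (A B : set T) :
  hausdorff_space T -> compact [set: T] -> closed A -> closed B ->
  A `&` B `<=` set0 ->
  exists U V : set T,
    [/\ open U, open V, A `<=` U, B `<=` V & U `&` V `<=` set0].
Proof.
move=> hT cT cA cB AB0.
have nA : set_nbhs A (~` B).
  by apply/set_nbhsP; exists (~` B); split=> // [|x Ax Bx];
    [exact: closed_openC|exact: (AB0 x)].
have [D /set_nbhsP[C [oC AC CD]] DB] := compact_normal hT cT cA nA.
exists C, (~` closure D); split=> //.
- by rewrite openC; exact: closed_closure.
- by move=> x Bx /DB.
- by move=> x [Cx]; apply; apply: subset_closure; exact: CD.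
Qed.

Lemma dense_agree (T U : topologicalType) (D : set T) (f g : T -> U) :
  hausdorff_space U -> dense D -> continuous f -> continuous g ->
  (forall x, D x -> f x = g x) -> f = g.
Proof.
move=> hU dD cf cg fg; apply/funext => x; apply: hU => A B nA nB.
have nx : nbhs x (f @^-1` A `&` g @^-1` B).
  by apply: filterI; [exact: cf|exact: cg].
move: nx; rewrite nbhsE => -[O [oO Ox] OAB].
have [||z [/OAB[Az Bz] Dz]] := dD O; [by exists x|by []|].
by exists (f z); split=> //; rewrite fg.
Qed.

Lemma ultra_of_setVsetC (T : Type) (F : set_system T) :
  ProperFilter F -> (forall A, F A \/ F (~` A)) -> UltraFilter F.
Proof.
move=> PF FC; split=> // G PG FG; apply/seteqP; split=> // A GA.
have [//|/FG GnA] := FC A.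
by have [x []] := filter_ex (filterI GA GnA).
Qed.

(** If the preimage of a neighborhood W of f x were not a neighborhood of x,
    some ultrafilter converging to x would contain its complement. *)
Lemma continuous_at_ultra (T U : topologicalType) (f : T -> U) (x : T) :
  (forall F : set_system T, UltraFilter F -> F --> x -> f @ F --> f x) ->
  {for x, continuous f}.
Proof.
move=> fF W nW; apply: contrapT => nfW.
have PF : ProperFilter (within (~` (f @^-1` W)) (nbhs x)).
  apply: Build_ProperFilter_ex => P wP; apply: contrapT => nP.
  apply: nfW; move: wP; rewrite /within /=; apply: filterS => y /= Py; apply: contrapT => nWy.
  by apply: nP; exists y; exact: Py.
have [F [UF sF]] := ultraFilterLemma PF.
have Fx : F --> x by move=> P nP; apply: sF; exact: cvg_within nP.
have FW : F (f @^-1` W) by exact: (fF F UF Fx).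
have FnW : F (~` (f @^-1` W)) by apply: sF; exact: withinT.
by have [y []] := filter_ex (filterI FW FnW).
Qed.

(** * Idempotents in compact right topological semigroups *)

Section EllisNumakura.
Variable S : topologizedSemigroupType.
Hypotheses (hS : hausdorff_space S) (cS : compact [set: S]).
Hypothesis rS : right_topological S.

Definition closed_subsemigroup (A : set S) :=
  [/\ closed A, A !=set0 & forall x y, A x -> A y -> A (x * y)].

(** Zorn's lemma applied to the open sets A removed from L.  A chain of them
    cannot exhaust L: by compactness the decreasing family of the nonempty
    closed sets L \ A has a common point. *)
Lemma exists_minimal_closed_subsemigroup (L : set S) :
  closed_subsemigroup L ->
  exists M, [/\ closed_subsemigroup M, M `<=` L &
    forall N, closed_subsemigroup N -> N `<=` M -> N = M].
Proof.
move=> [cL [a La] mL].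
pose P (A : set S) := closed_subsemigroup (L `\` A) /\ open A.
have [F FP totF|A [[sgA oA] maxA]] := @Zorn_bigcup S P.
  have oF : open (\bigcup_(X in F) X).
    by apply: bigcup_open => X /FP[].
  split=> //; split.
  - by rewrite setDE; apply: closedI => //; exact: open_closedC.
  (* For the empty chain the intersection is L itself. *)
  - have [->|/set0P[X0 FX0]] := eqVneq F set0.
      by exists a; split=> // -[].
    pose B := filter_from F (fun X => L `\` X).
    have PB : ProperFilter B.
      apply: filter_from_proper => [|X /FP[[]]//].
      apply: filter_from_filter; first by exists X0.
      move=> X Y FX FY; have [XY|YX] := totF X Y FX FY.
        by exists Y => // z [Lz nYz]; split; split=> // /XY.
      by exists X => // z [Lz nXz]; split; split=> // /YX.
    have BX X : F X -> B (L `\` X) by move=> FX; exists X.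
    have [p [_ clp]] := cS PB filterT.
    have clX X : F X -> (L `\` X) p.
      move=> FX; have [[cX _ _] _] := FP _ FX; apply: cX => W nW.
      exact: clp (BX _ FX) nW.
    exists p; split; first by have [] := clX _ FX0.
    by move=> [X FX Xp]; have [] := clX _ FX.
  - move=> x y [Lx nx] [Ly ny]; split; first exact: mL.
    move=> [X FX]; have [[_ _ mX] _] := FP _ FX.
    have [||_ //] := mX x y.
    + by split=> // Xx; apply: nx; exists X.
    + by split=> // Xy; apply: ny; exists X.
exists (L `\` A); split=> //.
move=> N sN NLA.
apply/seteqP; split=> // x [Lx nAx]; apply: contrapT => nNx.
have [cN _ _] := sN.
apply: (maxA (~` N)).
  split; first by move=> y Ay /NLA[].
  by move=> /(_ x nNx).
split; last exact: closed_openC.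
rewrite setDE setCK (_ : L `&` N = N) //.
by apply/seteqP; split=> y; [case|move=> Ny; split=> //; case: (NLA _ Ny)].
Qed.

Lemma closed_right_translate (A : set S) (x : S) :
  closed A -> closed [set y * x | y in A].
Proof.
move=> cA; apply: compact_closed => //; apply: continuous_compact.
  exact/continuous_subspaceT/rS.
exact: subclosed_compact cA cS _.
Qed.

(** Any x in a minimal closed subsemigroup M is idempotent: M x is a closed
    subsemigroup of M, hence equal to M, so the solutions y in M of y x = x
    form a nonempty closed subsemigroup.  By minimality again this is all of
    M, and x itself is a solution. *)
Theorem ellis_numakura (L : set S) :
  closed_subsemigroup L -> exists2 e, L e & e * e = e.
Proof.
case/exists_minimal_closed_subsemigroup=> [M [[cM [x Mx] mulM] ML minM]].
have Mxx : [set y * x | y in M] = M.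
  apply: minM; last by move=> _ [y My <-]; exact: mulM.
  split; first exact: closed_right_translate.
  - by exists (x * x); exists x.
  - move=> _ _ [y My <-] [z Mz <-]; exists (y * x * z).
      by apply: (mulM _ _ _ Mz); exact: mulM.
    by rewrite !mulgA.
have Nxx : M `&` [set y | y * x = x] = M.
  apply: minM; last by move=> y [].
  split.
  - apply: closedI => //.
    apply: (@preimage_closed _ _ (fun y : S => y * x) [set x]).
      by move=> y _; exact: rS.
    exact: accessible_closed_set1 (hausdorff_accessible hS) _.
  - have : M x by [].
    by rewrite -{1}Mxx => -[y My yx]; exists y.
  - move=> y z [My yx] [Mz zx]; split; first exact: mulM.
    by rewrite /= -mulgA zx.
exists x; first exact: ML.
by move: Mx; rewrite -{1}Nxx => -[].
Qed.

End EllisNumakura.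

(** * Quotients by closed congruences *)

Section ClosedQuotient.
Variables (S : topologizedSemigroupType) (rho : congr S).

Lemma congr_class_surj (a : congr_quotient rho) :
  exists x, a = congr_class rho x.
Proof. by exists (repr a); rewrite /congr_class reprK. Qed.

Lemma congr_class_morph (x y : S) :
  congr_class rho (x * y) = congr_class rho x * congr_class rho y.
Proof. by rewrite -congr_quotient_mulE. Qed.

Lemma congr_class_continuous : continuous (congr_class rho).
Proof. exact: pi_continuous. Qed.

Lemma congr_quotient_continuous (U : topologicalType)
    (f : congr_quotient rho -> U) (g : S -> U) :
  (forall x, f (congr_class rho x) = g x) -> continuous g -> continuous f.
Proof. by move=> /funext fg cg; apply/quotient_continuous; rewrite [_ \o _]fg. Qed.

Lemma congr_quotient_compact :
  compact [set: S] -> compact [set: congr_quotient rho].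
Proof.
move=> cS; suff -> : [set: congr_quotient rho] = congr_class rho @` setT.
  apply: continuous_compact => //.
  exact/continuous_subspaceT/congr_class_continuous.
by apply/seteqP; split=> // a _; have [x ->] := congr_class_surj a; exists x.
Qed.

Lemma congr_quotient_right_topological :
  right_topological S -> right_topological (congr_quotient rho).
Proof.
move=> rS b; have [s ->] := congr_class_surj b.
apply: (congr_quotient_continuous (fun x => esym (congr_class_morph x s))) => x.
by apply: continuous_comp; [exact: rS|exact: congr_class_continuous].
Qed.

Lemma congr_class_center (s : S) :
  topological_center S s ->
  topological_center (congr_quotient rho) (congr_class rho s).
Proof.
move=> cs; apply: (congr_quotient_continuous (fun x => esym (congr_class_morph s x))) => x.
by apply: continuous_comp; [exact: cs|exact: congr_class_continuous].
Qed.

Lemma congr_class_dense (D : set S) :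
  dense D -> dense (congr_class rho @` D).
Proof.
move=> dD O [a Oa] oO; have [x ax] := congr_class_surj a.
have [||y [Oy Dy]] := dD (congr_class rho @^-1` O).
- by exists x; rewrite /= -ax.
- exact: open_comp (in1W congr_class_continuous) oO.
- by exists (congr_class rho y); split=> //; exists y.
Qed.

Section Hausdorff.
Hypotheses (hS : hausdorff_space S) (cS : compact [set: S]).
Hypothesis crho : closed (congr_set rho).

(** The saturation of F is the second projection of the compact set
    rho /\ (F x S). *)
Lemma saturation_closed (F : set S) :
  closed F -> closed [set y | exists2 x, F x & congr_set rho (x, y)].
Proof.
move=> cF; set G := congr_set rho `&` (fst @^-1` F).
have -> : [set y | exists2 x, F x & congr_set rho (x, y)] = snd @` G.
  apply/seteqP; split=> [y [x Fx xy]|y [[x z] [/= xz Fx] <-]].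
    by exists (x, y).
  by exists x.
apply: compact_closed => //; apply: continuous_compact.
  by apply: continuous_subspaceT => z; exact: cvg_snd.
apply: (subclosed_compact _ (compact_setX cS cS)) => //.
apply: closedI => //; apply: preimage_closed => // z _; exact: cvg_fst.
Qed.

(** Two distinct classes are disjoint closed sets, so they have disjoint open
    neighborhoods U and V in S.  Removing from U and V the saturations of their
    complements, which are closed, leaves saturated open sets that still
    contain the two classes. *)
Lemma congr_quotient_hausdorff : hausdorff_space (congr_quotient rho).
Proof.
have [r s t _] := congrP rho.
move=> a b; have [x ->] := congr_class_surj a; have [y ->] := congr_class_surj b.
move=> ab; apply: contrapT => nxy.
(* The class of x, written as a saturation so that saturation_closed applies. *)
pose fiber x := [set z | exists2 x', [set x] x' & congr_set rho (x', z)].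
have c1 z : closed [set z : S].
  exact: accessible_closed_set1 (hausdorff_accessible hS) _.
have cfib z : closed (fiber z) by exact: saturation_closed.
have [|U [V [oU oV xU yV UV]]] :=
    compact_hausdorff_separation hS cS (cfib x) (cfib y).
  move=> z [[_ -> xz] [_ -> yz]]; apply: nxy; apply/congr_classP.
  by apply: t xz _; exact: s.
pose core (W : set S) := ~` [set z | exists2 x, (~` W) x & congr_set rho (x, z)].
have coreW W : core W `<=` W.
  by move=> z nz; apply: contrapT => nW; apply: nz; exists z.
have nb W z : open W -> fiber z `<=` W ->
    nbhs (congr_class rho z) [set c | exists2 w, core W w & c = congr_class rho w].
  move=> oW zW; apply: open_nbhs_nbhs; split; last first.
    exists z => //; move=> [w nWw wz]; apply: nWw; apply: zW.
    by exists z => //; exact: s.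
  rewrite /open /= /quotient_open.
  suff -> : \pi_(congr_quotient rho) @^-1`
      [set c | exists2 w, core W w & c = congr_class rho w] = core W.
    by apply: closed_openC; apply: saturation_closed; exact: open_closedC.
  apply/seteqP; split=> w /=; last by exists w.
  move=> [v cv /congr_classP wv] [u nWu uw]; apply: cv; exists u => //.
  exact: t uw wv.
have [_ [[u cu ->] [v cv /congr_classP uv]]] := ab _ _ (nb _ _ oU xU) (nb _ _ oV yV).
apply: (UV u); split; first exact: coreW.
apply: contrapT => nVu; apply: cv; exists u => //.
Qed.

End Hausdorff.
End ClosedQuotient.

(** * The Stone-Cech compactification of a discrete semigroup *)

Section StoneCech.
Variable S : semigroupType.
Implicit Types u v w : beta S.

Let beta_filter_proper u : ProperFilter u := @ultra_proper _ _ (beta_ultra u).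
Local Existing Instance beta_filter_proper.

Lemma beta_setC u (A : set S) : u A \/ u (~` A).
Proof. exact: in_ultra_setVsetC (beta_ultra u). Qed.

Lemma beta_not_setC u (A : set S) : u A -> u (~` A) -> False.
Proof. by move=> uA uC; have [x []] := filter_ex (filterI uA uC). Qed.

Lemma open_beta_basic (A : set S) : open (beta_basic A).
Proof. by exists [set A] => //; rewrite bigcup_set1. Qed.

Lemma nbhs_betaP u (W : set (beta S)) :
  nbhs u W <-> exists2 A, u A & beta_basic A `<=` W.
Proof.
split; last first.
  move=> [A uA AW]; apply: filterS AW _; apply: open_nbhs_nbhs; split=> //.
  exact: open_beta_basic.
rewrite nbhsE => -[O [[D _ DO] Ou] OW].
move: Ou; rewrite -DO => -[A DA uA]; exists A => // w wA.
by apply: OW; rewrite -DO; exists A.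
Qed.

Lemma continuous_to_beta (T : topologicalType) (f : T -> beta S) :
  (forall A, open (f @^-1` beta_basic A)) -> continuous f.
Proof.
move=> fA x W /nbhs_betaP[A fxA AW]; apply: filterS (preimage_subset AW) _.
by apply: open_nbhs_nbhs; split; [exact: fA|].
Qed.

Lemma beta_hausdorff : hausdorff_space (beta S).
Proof.
move=> u v uv; have uSv A : u A -> v A.
  move=> uA; have [//|vnA] := beta_setC v A.
  have nu : nbhs u (beta_basic A) by apply/nbhs_betaP; exists A.
  have nv : nbhs v (beta_basic (~` A)) by apply/nbhs_betaP; exists (~` A).
  by have [w [wA /(beta_not_setC wA)]] := uv _ _ nu nv.
apply: beta_eqP => A; split=> [|vA]; first exact: uSv.
by have [//|/uSv /(beta_not_setC vA)] := beta_setC u A.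
Qed.

(** An ultrafilter F on beta S converges to the ultrafilter of those A whose
    basic open set belongs to F. *)
Lemma beta_compact : compact [set: beta S].
Proof.
rewrite compact_ultra => F UF _.
have PF : ProperFilter F := @ultra_proper _ _ UF.
have Pu : ProperFilter [set A : set S | F (beta_basic A)].
  apply: Build_ProperFilter_ex.
    by move=> A FA; have [u uA] := filter_ex (FA : F _); exact: filter_ex uA.
  split.
  - by apply: (@filterE _ F) => u; exact: filterT.
  - by move=> A B; apply: (@filterS2 _ F) => u; exact: filterI.
  - by move=> A B AB; apply: (@filterS _ F) => u; exact: filterS AB.
have Uu : UltraFilter [set A : set S | F (beta_basic A)].
  apply: ultra_of_setVsetC => A.
  have [|FnA] := in_ultra_setVsetC (beta_basic A) UF; first by left.
  right; apply: filterS FnA => u nuA.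
  by have [] := beta_setC u A.
exists (Beta Uu); split=> // W /nbhs_betaP[A FA AW].
exact: filterS AW FA.
Qed.

Lemma beta_principalE (x : S) (A : set S) : beta_principal x A <-> A x.
Proof. exact: principal_filterP. Qed.

Lemma cvg_beta_principal u : @beta_principal S @ (u : set_system S) --> u.
Proof.
move=> W /nbhs_betaP[A uA AW].
by apply: filterS uA => x Ax; apply: AW; exact/beta_principalE.
Qed.

Lemma beta_principal_dense : dense (range (@beta_principal S)).
Proof.
move=> O [u Ou] oO.
have uO : u (@beta_principal S @^-1` O).
  by apply: cvg_beta_principal; exact: open_nbhs_nbhs.
have [x Ox] := filter_ex uO.
by exists (beta_principal x); split=> //; exists x.
Qed.

Lemma beta_mul_principalE u (y : S) (A : set S) :
  (u * beta_principal y)%g A <-> u [set s | A (s * y)].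
Proof.
split; apply: (@filterS _ (beta_filter u)) => s; first by move=> /principal_filterP.
by move=> Asy; exact/principal_filterP.
Qed.

Lemma beta_principal_mulE (x : S) v (A : set S) :
  (beta_principal x * v)%g A <-> v [set t | A (x * t)].
Proof. exact: beta_principalE. Qed.

Lemma beta_principal_morph : homomorphism (@beta_principal S).
Proof.
move=> x y; apply: beta_eqP => A; rewrite beta_principal_mulE.
by split=> /beta_principalE ?; apply/beta_principalE.
Qed.

Lemma beta_right_topological : right_topological (beta S).
Proof. by move=> v; apply: continuous_to_beta => A; exact: open_beta_basic. Qed.

Lemma beta_principal_center (x : S) :
  topological_center (beta S) (beta_principal x).
Proof.
apply: continuous_to_beta => A.
rewrite (_ : _ @^-1` _ = beta_basic [set t | A (x * t)]).
  exact: open_beta_basic.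
by apply/seteqP; split=> v /beta_principal_mulE.
Qed.

(** F u is the limit in H of the ultrafilter f @ u.  Continuity uses the
    regularity of H: if a neighborhood V of F u has its closure in W, then
    every w containing f^-1(V) has its limit in the closure of V. *)
Lemma beta_extension (H : topologicalType) (f : S -> H) :
  hausdorff_space H -> compact [set: H] ->
  exists2 F : beta S -> H, continuous F & forall x, F (beta_principal x) = f x.
Proof.
move=> hH cH.
have lim u : exists p : H, f @ (u : set_system S) --> p.
  have Uf : UltraFilter (f @ (u : set_system S)).
    by apply: ultra_of_setVsetC => A; exact: beta_setC.
  have [p [_ fp]] : [set: H] `&` [set p | f @ (u : set_system S) --> p] !=set0.
    by move: cH; rewrite compact_ultra; apply => //; exact: filterT.
  by exists p.
have [F Fu] := choice lim; exists F => [u W nW|x].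
  have [V nV VW] := compact_regular hH cH filterT nW.
  apply/nbhs_betaP; exists (f @^-1` V); first exact: (Fu u _ nV).
  move=> w wV; apply: VW => B nB.
  have wB : w (f @^-1` B) by exact: (Fu w _ nB).
  by have [x [Vx Bx]] := filter_ex (filterI wV wB); exists (f x).
apply: hH => A B nA nB; exists (f x); split; last exact: nbhs_singleton.
have /beta_principalE // : beta_principal x (f @^-1` A) by exact: (Fu _ _ nA).
Qed.

(** Two continuous maps that agree on the principal ultrafilters are equal.
    The order of the two steps matters: the left shifts of beta S known to be
    continuous are those by points of S, so the right factor is extended to beta S while the left one
    is still a point of S. *)
Lemma beta_extension_morph (H : topologizedSemigroupType) (F : beta S -> H) :
  hausdorff_space H -> right_topological H -> continuous F ->
  homomorphism (F \o @beta_principal S) ->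
  range (F \o @beta_principal S) `<=` topological_center H ->
  homomorphism F.
Proof.
move=> hH rH cF mF FH u v.
have Fx x : (fun w => F (beta_principal x * w)) =
            (fun w => F (beta_principal x) * F w).
  apply: (dense_agree hH beta_principal_dense) => [w|w|_ [y _ <-]].
  - by apply: continuous_comp; [exact: beta_principal_center|exact: cF].
  - apply: (continuous_comp (cF w)) (FH (F (beta_principal x)) _ (F w)).
    by exists x.
  - by rewrite -beta_principal_morph; exact: mF.
suff /(congr1 (fun g => g u)) : (fun w => F (w * v)) = (fun w => F w * F v) by [].
apply: (dense_agree hH beta_principal_dense) => [w|w|_ [x _ <-]].
- by apply: continuous_comp; [exact: beta_right_topological|exact: cF].
- exact: (continuous_comp (cF w)) (rH (F v) (F w)).
- exact: (congr1 (fun g => g v) (Fx x)).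
Qed.

End StoneCech.

(** * The universal chartification *)

Lemma beta_principal1 (G : groupType) (u : beta G) :
  beta_principal 1 * u = u /\ u * beta_principal 1 = u.
Proof.
have UF := beta_ultra u.
split; apply: beta_eqP => A.
  rewrite beta_principal_mulE.
  by rewrite (_ : [set t | _] = A) //; apply/funext => t /=; rewrite mul1g.
rewrite beta_mul_principalE.
by rewrite (_ : [set t | _] = A) //; apply/funext => t /=; rewrite mulg1.
Qed.

Lemma congr_kernel (S T : topologizedSemigroupType) (F : S -> T) :
  hausdorff_space T -> continuous F -> homomorphism F ->
  closed_congruence [set xy : S * S | F xy.1 = F xy.2].
Proof.
move=> hT cF mF; split.
  split=> [//|x y /= ->//|x y z /= -> //|a1 b1 a2 b2 /= e1 e2].
  by rewrite !mF e1 e2.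
move=> [x y] cl; apply: hT => A B nA nB.
have [|[z w] [/= Fzw [/= Az Bw]]] := cl ((F @^-1` A) `*` (F @^-1` B)).
  by exists (F @^-1` A, F @^-1` B) => //; split; exact: cF.
by exists (F z); split=> //; rewrite Fzw.
Qed.

Section UniversalChartification.
Variable G : topologizedGroupType.
Hypothesis rG : right_topological G.

Let e1 : beta G := beta_principal 1.

Lemma Phi_closed : closed (congr_set (Phi G)).
Proof. by have [] := smallest_closed_congruence (Phi_generators G). Qed.

Lemma Phi_idempotent (u : beta G) :
  u * u = u -> congr_class (Phi G) u = congr_class (Phi G) e1.
Proof.
move=> uu; apply/congr_classP => rho [_ gen]; apply: gen.
by left; exists u.
Qed.

Lemma Phi_Ult (u : beta G) :
  Ult G u -> congr_class (Phi G) u = congr_class (Phi G) e1.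
Proof.
move=> uu; apply/congr_classP => rho [_ gen]; apply: gen.
by right; exists u.
Qed.

(** The ultrafilter u x^-1 converges to 1, by continuity of the right shift by
    x^-1, so it becomes trivial in the quotient; multiply back by x. *)
Lemma Phi_cvg (u : beta G) (x : G) :
  (u : set_system G) --> x -> congr_class (Phi G) u = h_Phi x.
Proof.
move=> ux; have UF := beta_ultra u.
have Ux : Ult G (u * beta_principal x^-1).
  move=> W nW; apply/beta_mul_principalE; apply: ux; apply: rG.
  by rewrite mulgV.
have [_ u1] := beta_principal1 u.
rewrite -{1}u1 -(mulVg x) beta_principal_morph mulgA congr_class_morph.
rewrite (Phi_Ult Ux) -congr_class_morph.
by have [-> _] := beta_principal1 (beta_principal x).
Qed.

Lemma h_Phi_continuous : continuous (@h_Phi G).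
Proof.
move=> x; apply: continuous_at_ultra => F UF Fx.
rewrite -(@Phi_cvg (Beta UF) x Fx).
apply: cvg_comp (@cvg_beta_principal _ (Beta UF)) _.
exact: congr_class_continuous.
Qed.

(** A left inverse of the class of u comes from an idempotent of the left ideal
    (beta G) u. *)
Lemma beta_quotient_is_group : is_group (congr_quotient (Phi G)).
Proof.
have left_inv (a : congr_quotient (Phi G)) :
    exists b, b * a = congr_class (Phi G) e1.
  have [u ->] := congr_class_surj a.
  have [|_ [v _ <-] ee] := @ellis_numakura (beta G) (@beta_hausdorff _)
      (@beta_compact _) (@beta_right_topological _) [set v * u | v in setT].
    split.
    - apply: closed_right_translate; [exact: beta_hausdorff|exact: beta_compact
        |exact: beta_right_topological|exact: closedT].
    - by exists (u * u); exists u.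
    - move=> _ _ [v _ <-] [w _ <-]; exists (v * u * w) => //.
      by rewrite !mulgA.
  exists (congr_class (Phi G) v); rewrite -congr_class_morph.
  exact: Phi_idempotent.
have one_mul (a : congr_quotient (Phi G)) :
    congr_class (Phi G) e1 * a = a /\ a * congr_class (Phi G) e1 = a.
  have [u ->] := congr_class_surj a; have [e1u ue1] := beta_principal1 u.
  by rewrite -!congr_class_morph e1u ue1.
exists (congr_class (Phi G) e1); split=> // a.
(* If b a = 1 and c b = 1 then c = c (b a) = (c b) a = a. *)
have [b ba] := left_inv a; have [c cb] := left_inv b; exists b; split=> //.
suff <- : c = a by [].
by have [_ <-] := one_mul c; rewrite -ba mulgA cb; have [-> _] := one_mul a.
Qed.

Lemma range_h_Phi_center :
  range (@h_Phi G) `<=` topological_center (congr_quotient (Phi G)).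
Proof.
by move=> _ [x _ <-]; apply: congr_class_center; exact: beta_principal_center.
Qed.

Lemma range_h_Phi_dense : dense (range (@h_Phi G)).
Proof.
have := congr_class_dense (rho := Phi G) (@beta_principal_dense G).
by rewrite image_comp.
Qed.

Lemma beta_quotient_chart_group : chart_group (congr_quotient (Phi G)).
Proof.
split.
- exact: beta_quotient_is_group.
- exact/congr_quotient_right_topological/beta_right_topological.
- move=> O O0 oO; have [a [Oa ra]] := range_h_Phi_dense O0 oO.
  by exists a; split=> //; exact: range_h_Phi_center.
- exact/congr_quotient_compact/beta_compact.
- apply: congr_quotient_hausdorff;
    [exact: beta_hausdorff|exact: beta_compact|exact: Phi_closed].
Qed.

(** A group has only one idempotent, so F sends idempotents to the unit.  For u
    converging to 1, the images under F of the points of G converge along u to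
    F u since F is continuous, and to F 1 since F is continuous on G itself. *)
Lemma Phi_sub_kernel (H : topologizedSemigroupType) (F : beta G -> H) :
  is_group H -> hausdorff_space H -> continuous F -> homomorphism F ->
  continuous (F \o @beta_principal G) ->
  congr_set (Phi G) `<=` [set uv | F uv.1 = F uv.2].
Proof.
move=> [e [eid einv]] hH cF mF cf uv; apply; split; first exact: congr_kernel.
have idem a : a * a = a -> a = e.
  move=> aa; have [b [ba _]] := einv a.
  by rewrite -ba -[in RHS]aa mulgA ba; have [->] := eid a.
have F1 : F e1 = e.
  by apply: idem; rewrite -mF; have [->] := beta_principal1 e1.
move=> _ [[u uu <-]|[u uu <-]] /=; rewrite -/e1.
  by rewrite F1; apply: idem; rewrite -mF uu.
have UF := beta_ultra u.
have PF : ProperFilter (F \o @beta_principal G @ (u : set_system G)).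
  exact: fmap_proper_filter.
have l1 : F \o @beta_principal G @ (u : set_system G) --> F u.
  exact: cvg_comp (@cvg_beta_principal _ u) (cF u).
have l2 : F \o @beta_principal G @ (u : set_system G) --> F e1.
  move=> W nW; exact: uu _ (cf 1 W nW).
exact: cvg_unique l1 l2.
Qed.

End UniversalChartification.

Theorem theorem2p8 (G : topologizedGroupType) :
  hausdorff_space G -> right_topological G ->
  universal_chartification (@h_Phi G).
Proof.
move=> _ rG; split.
- exact: beta_quotient_chart_group.
- split; first exact: h_Phi_continuous.
  by move=> x y; rewrite /h_Phi beta_principal_morph congr_class_morph.
- exact: range_h_Phi_dense.
- exact: range_h_Phi_center.
- move=> H f [gH rH _ cH hH] cf mf fH.
  have [F cF Ff] := beta_extension f hH cH.
  have Ef : F \o @beta_principal G = f by apply/funext => x /=.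
  have mF : homomorphism F by apply: beta_extension_morph; rewrite ?Ef.
  have ker := Phi_sub_kernel gH hH cF mF.
  rewrite Ef in ker; have {}ker := ker cf.
  pose g (a : congr_quotient (Phi G)) := F (repr a).
  have gE u : g (congr_class (Phi G) u) = F u.
    apply: (ker (_, u)); apply/congr_classP.
    by rewrite /congr_class reprK.
  exists g; split.
  + exact: congr_quotient_continuous gE cF.
  + move=> a b; have [u ->] := congr_class_surj a.
    have [v ->] := congr_class_surj b.
    by rewrite -congr_class_morph !gE mF.
  + by apply/funext => x; rewrite /= /h_Phi gE.
Qed.
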